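(* Let $(Z,\mathcal U)$ be a compact $g$-quasi uniform space. Then $(Z,\mathcal U)$ is strongly Lebesgue, i.e. every pseudo-Cauchy net in $(Z,\mathcal U)$ has a cluster point in $Z$.
   Context: A $g$-quasi uniformity (generalized quasi-uniformity) on a nonempty set $Z$ is a nonempty collection $\mathcal U\subset\mathcal P(Z\times Z)$ such that (i) $\Delta(Z)=\{(z,z):z\in Z\}\subset U$ for all $U\in\mathcal U$; (ii) $U\in\mathcal U$ and $U\subset V\subset Z\times Z$ imply $V\in\mathcal U$; (iii) for each $U\in\mathcal U$ there is $V\in\mathcal U$ with $V\circ V\subset U$, where $V\circ V=\{(x,z):\exists y,\ (x,y)\in V,(y,z)\in V\}$. (Closure under intersection is not required.) The pair $(Z,\mathcal U)$ is called a $g$-quasi uniform space. For $U\in\mathcal U$ and $x\in Z$ put $U(x)=\{y\in Z:(x,y)\in U\}$. The collection $\mu(\mathcal U)=\{G\subset Z: \text{for every }x\in G\text{ there is }U\in\mathcal U\text{ with }U(x)\subset G\}$ is the induced supratopology (it contains $\emptyset$ and $Z$ and is closed under arbitrary unions). Members of $\mu(\mathcal U)$ are called generalized open. A generalized neighborhood of $a\in Z$ is a set $A\subset Z$ with $a\in G\subset A$ for some $G\in\mu(\mathcal U)$. $(Z,\mathcal U)$ is compact if $(Z,\mu(\mathcal U))$ is compact, i.e. every cover of $Z$ by members of $\mu(\mathcal U)$ has a finite subcover. A net $(S_n)_{n\in D}$ in $Z$ is a map from a directed set $(D,\ge)$ to $Z$, with $S_n$ the image of $n$. A point $c\in Z$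 is a cluster point of $(S_n)_{n\in D}$ if for every generalized neighborhood $A$ of $c$ and every $n\in D$ there is $m\in D$ with $m\ge n$ and $S_m\in A$. The net is pseudo-Cauchy if for every $U\in\mathcal U$ and $p\in D$ there exist $m,n\in D$ with $m\neq n$, $m,n\ge p$ and $(S_m,S_n)\in U$. $(Z,\mathcal U)$ is strongly Lebesgue if every pseudo-Cauchy net in $Z$ has a cluster point in $Z$. *)

(* Defs.v *)
From mathcomp Require Import all_boot.
From mathcomp Require Import classical_sets cardinality.

Set Implicit Arguments.
Unset Strict Implicit.
Unset Printing Implicit Defensive.

Local Open Scope classical_set_scope.

Record is_gquasi_uniformity (Z : Type) (UU : set_system (Z * Z)) : Prop := {
  gqu_carrier_nonempty : [set: Z] !=set0;
  gqu_nonempty : UU !=set0;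
  gqu_refl : forall U, UU U -> diagonal `<=` U;
  gqu_upward : forall U V, UU U -> U `<=` V -> UU V;
  gqu_split : forall U, UU U -> exists2 V, UU V & (V \; V)%relation `<=` U
}.

Definition generalized_open (Z : Type) (UU : set_system (Z * Z)) :
    set_system Z :=
  [set G | forall x, G x -> exists2 U, UU U & xsection U x `<=` G].

Definition generalized_nbhs (Z : Type) (UU : set_system (Z * Z)) (a : Z) :
    set_system Z :=
  [set A | exists G, [/\ generalized_open UU G, G a & G `<=` A]].

Definition gqu_compact (Z : Type) (UU : set_system (Z * Z)) : Prop :=
  forall C : set_system Z,
    C `<=` generalized_open UU -> [set: Z] `<=` \bigcup_(G in C) G ->
    exists F : set_system Z,
      [/\ F `<=` C, finite_set F & [set: Z] `<=` \bigcup_(G in F) G].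

(* [ge m n] reads m >= n.  As usual for nets, a directed set is a nonempty
   preorder (antisymmetry is not required) with pairwise upper bounds. *)
Record is_directed (D : Type) (ge : D -> D -> Prop) : Prop := {
  directed_nonempty : [set: D] !=set0;
  directed_refl : forall n, ge n n;
  directed_trans : forall m n p, ge m n -> ge n p -> ge m p;
  directed_ub : forall m n, exists p, ge p m /\ ge p n
}.

Definition is_cluster_point (Z : Type) (UU : set_system (Z * Z))
    (D : Type) (ge : D -> D -> Prop) (S : D -> Z) (c : Z) : Prop :=
  forall A, generalized_nbhs UU c A ->
  forall n, exists m, ge m n /\ A (S m).

Definition pseudo_Cauchy (Z : Type) (UU : set_system (Z * Z))
    (D : Type) (ge : D -> D -> Prop) (S : D -> Z) : Prop :=
  forall U, UU U -> forall p,
  exists m n, [/\ m <> n, ge m p, ge n p & U (S m, S n)].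

Definition strongly_Lebesgue (Z : Type) (UU : set_system (Z * Z)) : Prop :=
  forall (D : Type) (ge : D -> D -> Prop) (S : D -> Z),
    is_directed ge -> pseudo_Cauchy UU ge S ->
    exists c, is_cluster_point UU ge S c.

(* Main.v *)
Require Import Defs.
From mathcomp Require Import all_boot.
From mathcomp Require Import classical_sets.
From mathcomp Require Import boolp cardinality.

(** Compactness gives every net a cluster point.  If no
    point were a cluster point, every point would lie in a generalized open
    set which some tail of the net avoids, so the open sets avoided by a tail
    would cover the space.  A finite subcover consists of finitely many such
    sets, and directedness gives one index beyond all the tails involved
    ([directed_finite_tail]): the value of the net there lies in no member of
    the subcover.  The argument involves unions and finite subfamilies of open
    sets only, never an intersection of open sets, which is why it works in a
    supratopology ([compact_net_cluster_point]). *)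

Set Implicit Arguments.
Unset Strict Implicit.
Unset Printing Implicit Defensive.

Local Open Scope classical_set_scope.

(** Tails of a directed set have the finite intersection property: this is what
    turns a finite subcover into a single index at which the net escapes it. *)
Lemma directed_finite_tail (D : Type) (ge : D -> D -> Prop) (I : Type)
    (F : set I) (P : I -> D -> Prop) :
  is_directed ge -> finite_set F ->
  (forall i, F i -> exists n, forall m, ge m n -> P i m) ->
  exists p, forall i, F i -> P i p.
Proof.
move=> dir; elim/Pchoice: I => I in F P *.
move=> /finite_seqP[s ->] ev.
(* A whole tail, and not only a single index, is carried by the induction. *)
suff [p tail] : exists p, forall i, i \in s -> forall m, ge m p -> P i m.
  by exists p => i /tail; apply; exact: directed_refl.
elim: s ev => [_|i s IHs ev]; first by have [p _] := directed_nonempty dir; exists p.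
have [j js|p tail_s] := IHs; first by apply: ev; rewrite /= inE [X in _ || X]js orbT.
have [n tail_i] := ev i (mem_head i s).
have [q [q_n q_p]] := directed_ub dir n p.
exists q => j; rewrite inE => /orP[/eqP ->|js] m m_q.
  exact/tail_i/(directed_trans dir m_q).
exact/(tail_s j js)/(directed_trans dir m_q).
Qed.

(** Generalized neighborhoods may be shrunk to open sets, so the failure of
    clustering is witnessed by an open set, as a cover requires. *)
Lemma not_cluster_point_open (Z : Type) (UU : set_system (Z * Z))
    (D : Type) (ge : D -> D -> Prop) (S : D -> Z) (c : Z) :
  ~ is_cluster_point UU ge S c ->
  exists G, [/\ generalized_open UU G, G c &
                exists n, forall m, ge m n -> ~ G (S m)].
Proof.
move=> ncl; apply: contrapT => nG; apply: ncl => A [G [Gopen Gc GA]] n.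
apply: contrapT => nA; apply: nG; exists G; split=> //; exists n => m mn GSm.
by apply: nA; exists m; split=> //; exact: GA.
Qed.

Lemma compact_net_cluster_point (Z : Type) (UU : set_system (Z * Z))
    (D : Type) (ge : D -> D -> Prop) (S : D -> Z) :
  gqu_compact UU -> is_directed ge -> exists c, is_cluster_point UU ge S c.
Proof.
move=> cpt dir; apply: contrapT => /forallNP ncl.
pose C := [set G | generalized_open UU G /\
                   exists n, forall m, ge m n -> ~ G (S m)].
have [G []//|z _|F [FC finF Fcover]] := cpt C.
  by have [G [Gopen Gz avoid]] := not_cluster_point_open (ncl z); exists G.
have [|p avoid] := @directed_finite_tail D ge _ F (fun G m => ~ G (S m)) dir finF.
  by move=> G /FC[].
by have [G FG GSp] := Fcover (S p) I; exact: avoid FG GSp.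
Qed.

Theorem theorem3p7 (Z : Type) (UU : set_system (Z * Z))
  (hUU : is_gquasi_uniformity UU) (hcompact : gqu_compact UU) :
  strongly_Lebesgue UU.
Proof.
by move=> D ge S dir _; exact: compact_net_cluster_point.
Qed.
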